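(* Let $k\ge 1$ be an integer. Let $X\subseteq S^1$ be such that $\mathrm{diam}(X)<\frac{2\pi k}{2k+1}$. Then there is a raked homogeneous trigonometric polynomial of degree $2k-1$ that is positive on $X$. Moreover, there is a set $X \subseteq S^1$ of diameter $\frac{2\pi k}{2k+1}$ such that no raked homogeneous trigonometric polynomial of degree $2k-1$ is positive on $X$.
   Context: The circle $S^1=\mathbb{R}/2\pi\mathbb{Z}$ carries the geodesic metric of total circumference $2\pi$, and $\mathrm{diam}$ is taken with respect to it. A trigonometric polynomial is an expression $p(t)=c+\sum_{j=1}^n \bigl(a_j\cos(jt)+b_j\sin(jt)\bigr)$ with real coefficients, regarded as a function $S^1\to\mathbb{R}$. It is homogeneous if $c=0$. Its spectrum is the set of $j\in\{1,\dots,n\}$ with $a_j\ne 0$ or $b_j\neq 0$, and its degree is the largest element of its spectrum. It is raked if its spectrum consists only of odd integers. ''Positive on $X$'' means $p(x)>0$ for every $x\in X$. *)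

(* Defs.v *)
From HB Require Import structures.
From mathcomp Require Import all_boot all_order all_algebra.
From mathcomp Require Import all_classical all_reals all_analysis.
From mathcomp Require Import lra.
Set Implicit Arguments.
Unset Strict Implicit.
Unset Printing Implicit Defensive.
Import Order.TTheory GRing.Theory Num.Theory.
Local Open Scope classical_set_scope.
Local Open Scope ring_scope.
Local Open Scope quotient_scope.

Section Circle.
Variable R : realType.

Definition twopiZ : pred R := fun x => `[< exists m : int, x = pi *+ 2 *~ m >].

Lemma twopiZP (x : R) : reflect (exists m : int, x = pi *+ 2 *~ m) (x \in twopiZ).
Proof. exact: asboolP. Qed.

Lemma twopiZ_zmod_closed : zmod_closed twopiZ.
Proof.
split; first by apply/twopiZP; exists 0; rewrite mulr0z.
move=> x y /twopiZP[m ->] /twopiZP[n ->].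
by apply/twopiZP; exists (m - n); rewrite mulrzBr.
Qed.

HB.instance Definition _ := GRing.isZmodClosed.Build R twopiZ twopiZ_zmod_closed.

Definition circle := Quotient.quot (GRing.ZmodClosed.clone R twopiZ _).

HB.instance Definition _ := GRing.Zmodule.on circle.
HB.instance Definition _ := EqQuotient.on circle.

Lemma circle_eqP (s t : R) :
  reflect (exists m : int, s - t = pi *+ 2 *~ m)
          (\pi_circle s == \pi_circle t).
Proof. by rewrite -Quotient.idealrBE; exact: twopiZP. Qed.

(* The arc-length metric on R/2piZ is the quotient metric of R. *)
Definition geodist (x y : circle) : R :=
  inf [set `|s - t| | s in [set s | \pi_circle s = x]
                    & t in [set t | \pi_circle t = y]].

(* A real supremum: geodist is bounded by pi (geodist_le_pi); the diameter of
   the empty set is 0. *)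
Definition diam (X : set circle) : R := sup [set geodist x y | x in X & y in X].

End Circle.

(* The expression c + \sum_(1 <= j <= n) (a_j cos (j t) + b_j sin (j t)).
   Values of the coefficient functions outside 1..n are irrelevant. *)
Record trigpoly (R : realType) := TrigPoly {
  tp_size : nat;
  tp_const : R;
  tp_cos : nat -> R;
  tp_sin : nat -> R
}.

Section TrigPoly.
Variables (R : realType) (p : trigpoly R).

Definition tp_evalR (t : R) : R :=
  tp_const p +
  \sum_(1 <= j < (tp_size p).+1)
     (tp_cos p j * cos (j%:R * t) + tp_sin p j * sin (j%:R * t)).

(* Independent of the representative: see tp_eval_pi. *)
Definition tp_eval (x : circle R) : R := tp_evalR (repr x).

Definition homogeneous : Prop := tp_const p = 0.

Definition spectrum : seq nat :=
  [seq j <- iota 1 (tp_size p) | (tp_cos p j != 0) || (tp_sin p j != 0)].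

(* The maximum of an empty spectrum is 0. *)
Definition degree : nat := \max_(j <- spectrum) j.

Definition raked : Prop := forall j, j \in spectrum -> odd j.

Definition positive_on (X : set (circle R)) : Prop :=
  forall x, X x -> 0 < tp_eval x.

End TrigPoly.

Section Facts.
Variable R : realType.

Lemma geodist_has_lbound (x y : circle R) :
  lbound [set `|s - t| | s in [set s | \pi_(circle R) s = x]
                       & t in [set t | \pi_(circle R) t = y]] 0.
Proof. by move=> _ [s _ [t _ <-]]. Qed.

Lemma geodist_ge0 (x y : circle R) : 0 <= geodist x y.
Proof.
apply: lb_le_inf (@geodist_has_lbound x y).
by exists `|repr x - repr y|, (repr x); [exact: reprK|exists (repr y); [exact: reprK|]].
Qed.

Lemma geodist_le_pi (x y : circle R) : geodist x y <= pi.
Proof.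
pose d := repr x - repr y.
have pi2_gt0 : 0 < pi *+ 2 :> R by rewrite pmulrn_lgt0 ?pi_gt0.
pose m := Num.floor ((d + pi) / (pi *+ 2)).
have /andP[m1 m2] : m%:~R <= (d + pi) / (pi *+ 2) < (m + 1)%:~R.
  by rewrite floor_le floorD1_gt.
apply: (@le_trans _ _ `|repr x - (repr y + pi *+ 2 *~ m)|).
  apply: ge_inf; first by exists 0; exact: geodist_has_lbound.
  exists (repr x); first exact: reprK.
  exists (repr y + pi *+ 2 *~ m) => //=.
  rewrite -[RHS]reprK; apply/eqP/circle_eqP; exists m.
  by rewrite addrC addKr.
rewrite opprD addrA -/d ler_norml -mulrzl.
move: m1 m2; rewrite ler_pdivlMr// ltr_pdivrMr// intrD mulrDl mul1r mulr2n.
set u := _ * _ => m1 m2; apply/andP; split; lra.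
Qed.

Lemma cos_intperiod (t : R) (m : int) : cos (t + pi *+ 2 *~ m) = cos t.
Proof.
case: m => n; first by rewrite -pmulrn (periodicn (@cosD2pi R)).
by rewrite NegzE mulrNz -pmulrn -[LHS](periodicn (@cosD2pi R) n.+1) subrK.
Qed.

Lemma sin_intperiod (t : R) (m : int) : sin (t + pi *+ 2 *~ m) = sin t.
Proof.
case: m => n; first by rewrite -pmulrn (periodicn (@sinD2pi R)).
by rewrite NegzE mulrNz -pmulrn -[LHS](periodicn (@sinD2pi R) n.+1) subrK.
Qed.

Lemma tp_eval_pi (p : trigpoly R) (t : R) :
  tp_eval p (\pi_(circle R) t) = tp_evalR p t.
Proof.
rewrite /tp_eval; set s := repr _.
have /eqP/circle_eqP[m sE] : \pi_(circle R) s = \pi_(circle R) t by exact: reprK.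
rewrite -[s](subrK t) sE /tp_evalR; congr (_ + _); apply: eq_bigr => j _.
have -> : j%:R * (pi *+ 2 *~ m + t) = j%:R * t + pi *+ 2 *~ (m * j%:Z) :> R.
  by rewrite mulrDr addrC mulrzA -pmulrn -(mulr_natl (pi *+ 2 *~ m)).
by rewrite cos_intperiod sin_intperiod.
Qed.

End Facts.

(* Main.v *)
(* If X has diameter d, then X and its antipode X + pi are at distance at least
   g = pi - d > pi / (2k + 1).  Going from a point of X to its antipode one
   alternates between X and X + pi an odd number m of times, with steps of
   length at least g, so m < 2k + 1 and hence m <= 2k - 1.  The product of m
   sines vanishing at nodes placed inside the gaps is raked, of degree at most
   2k - 1, and bounded below by a positive constant on X; a small perturbation
   makes the degree exactly 2k - 1.  Conversely, a homogeneous polynomial of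
   degree less than 2k + 1 sums to 0 over the regular (2k + 1)-gon. *)
Require Import Defs.
From mathcomp Require Import all_boot all_order all_algebra.
From mathcomp Require Import all_classical all_reals all_analysis.
From mathcomp Require Import zify ring lra.
Import Order.TTheory GRing.Theory Num.Theory.
Set Implicit Arguments.
Unset Strict Implicit.
Local Open Scope classical_set_scope.
Local Open Scope ring_scope.

(** * Trigonometric polynomials of fixed parity *)

Section ParitySpan.
Variable R : realType.
Implicit Types (f : R -> R) (n j : nat).

(** These are the trigonometric polynomials of degree at most [n] with f (t + pi) = (-1)^n f t. For
    odd [n] they are raked and have no constant term; index 0 serves the constants that even [n]
    allows. *)
Definition parity_span n f : Prop :=
  exists a b : nat -> R,
    (forall j, odd j != odd n -> a j = 0 /\ b j = 0) /\
    forall t, f t =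
      \sum_(0 <= j < n.+1) (a j * cos (j%:R * t) + b j * sin (j%:R * t)).

Lemma eq_parity_span n f f' : f =1 f' -> parity_span n f -> parity_span n f'.
Proof. by move=> /funext ->. Qed.

Lemma parity_span0 n : parity_span n (fun=> 0).
Proof.
exists (fun=> 0), (fun=> 0); split=> // t.
by rewrite big1// => j _; rewrite !mul0r addr0.
Qed.

Lemma parity_spanD n f f' :
  parity_span n f -> parity_span n f' -> parity_span n (fun t => f t + f' t).
Proof.
move=> [a [b [ab0 fE]]] [a' [b' [ab0' fE']]].
exists (fun j => a j + a' j), (fun j => b j + b' j); split=> [j jn|t].
  have [-> ->] := ab0 j jn; have [-> ->] := ab0' j jn.
  by rewrite addr0.
by rewrite fE fE' -big_split/=; apply: eq_bigr => j _; ring.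
Qed.

Lemma parity_span_sum n (r : seq nat) (F : nat -> R -> R) :
  (forall j, j \in r -> parity_span n (F j)) ->
  parity_span n (fun t => \sum_(j <- r) F j t).
Proof.
elim: r => [|j r IH] Fr.
  by apply: (eq_parity_span _ (parity_span0 n)) => t; rewrite big_nil.
have rF i : i \in r -> parity_span n (F i) by move=> ir; apply: Fr; rewrite inE ir orbT.
apply: (eq_parity_span _ (parity_spanD (Fr j (mem_head _ _)) (IH rF))) => t.
by rewrite big_cons.
Qed.

Lemma parity_span_term n j (x y : R) : (j <= n)%N -> odd j = odd n ->
  parity_span n (fun t => x * cos (j%:R * t) + y * sin (j%:R * t)).
Proof.
move=> jn ojn.
exists (fun i => if i == j then x else 0), (fun i => if i == j then y else 0).
split=> [i|t]; first by case: (eqVneq i j) => // ->; rewrite ojn eqxx.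
rewrite (bigD1_seq j) ?mem_index_iota ?iota_uniq//= eqxx.
by rewrite big1 ?addr0// => i /negPf ->; rewrite !mul0r addr0.
Qed.

Lemma parity_span_widen m n f : (m <= n)%N -> odd m = odd n ->
  parity_span m f -> parity_span n f.
Proof.
move=> mn omn [a [b [ab0 fE]]].
apply: (eq_parity_span (fun t => esym (fE t))).
apply: parity_span_sum => j; rewrite mem_index_iota ltnS => /andP[_ jm].
have [ojm|ojm] := eqVneq (odd j) (odd m).
  by apply: parity_span_term; [exact: leq_trans mn|rewrite ojm].
have [-> ->] := ab0 j ojm.
by apply: (eq_parity_span _ (parity_span0 n)) => t; rewrite !mul0r addr0.
Qed.

(** By the product-to-sum formulas, the factor sin (u - t) moves frequency j to j - 1 and j + 1,
    which flips the parity. Frequency 0 yields frequency 1 only and is treated apart. *)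
Lemma parity_spanM_sin n f (u : R) :
  parity_span n f -> parity_span n.+1 (fun t => f t * sin (u - t)).
Proof.
move=> [a [b [ab0 fE]]].
apply: (@eq_parity_span _ (fun t => \sum_(0 <= j < n.+1)
  (a j * cos (j%:R * t) + b j * sin (j%:R * t)) * sin (u - t))).
  by move=> t; rewrite fE big_distrl.
apply: parity_span_sum => j; rewrite mem_index_iota ltnS => /andP[_ jn].
have [ojn|ojn] := eqVneq (odd j) (odd n); last first.
  have [-> ->] := ab0 j ojn.
  by apply: (eq_parity_span _ (parity_span0 n.+1)) => t; rewrite !mul0r addr0 mul0r.
case: j jn ojn => [|j] jn ojn.
  apply: (@eq_parity_span _ (fun t => a 0%N * sin u * cos (1%:R * t)
                               + - (a 0%N * cos u) * sin (1%:R * t))).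
    by move=> t; rewrite !mul0r cos0 sin0 sinB !mul1r; ring.
  by apply: parity_span_term => //=; rewrite -ojn.
set x := a _; set y := b _.
apply: (@eq_parity_span _ (fun t =>
  ((x * sin u + y * cos u) / 2 * cos (j.+2%:R * t)
   + (y * sin u - x * cos u) / 2 * sin (j.+2%:R * t))
  + ((x * sin u - y * cos u) / 2 * cos (j%:R * t)
   + (y * sin u + x * cos u) / 2 * sin (j%:R * t)))).
  move=> t.
  have -> : j.+2%:R * t = j.+1%:R * t + t by rewrite -[j.+2]addn1 natrD; ring.
  have -> : j%:R * t = j.+1%:R * t - t by rewrite -[j.+1]addn1 natrD; ring.
  by rewrite cosB !sinB cosD sinD; field.
have ojSn : odd j = odd n.+1 by rewrite /= -ojn /= negbK.
apply: parity_spanD; apply: parity_span_term => //.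
  by rewrite /= negbK.
by rewrite (leq_trans (leqnSn j))// (leq_trans jn).
Qed.

Lemma parity_span_prod_sin (s : seq R) :
  parity_span (size s) (fun t => \prod_(u <- s) sin (u - t)).
Proof.
elim: s => [|u s IH] /=.
  apply: (eq_parity_span _ (@parity_span_term 0 0 1 0 isT erefl)) => t.
  by rewrite big_nil !mul0r cos0 mulr1 addr0.
apply: (eq_parity_span _ (parity_spanM_sin u IH)) => t.
by rewrite big_cons mulrC.
Qed.

(* Adding a small multiple of [cos (n t)] makes the degree exactly [n]. *)
Lemma parity_span_trigpoly n f (e : R) : odd n -> 0 < e -> parity_span n f ->
  exists p : trigpoly R, [/\ raked p, homogeneous p, degree p = n &
    forall t, e <= f t -> 0 < tp_evalR p t].
Proof.
move=> on e0 [a [b [ab0 fE]]].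
have n0 : (0 < n)%N by case: n on {ab0 fE}.
(* The top coefficient changes only if it vanishes; the change costs at most half of the lower bound
   [e]. *)
pose h := if a n == 0 then e / 2 else 0.
pose a' i := if i == n then a n + h else a i.
have a'n : a' n != 0.
  rewrite /a' eqxx /h; have [->|//] := eqVneq (a n) 0; last by rewrite addr0.
  by rewrite add0r gt_eqF// divr_gt0.
exists (TrigPoly n 0 a' b); split=> //.
- move=> j; rewrite mem_filter /= => /andP[+ _].
  apply: contraTT => oj.
  have [a0 b0] : a j = 0 /\ b j = 0 by apply: ab0; rewrite on; case: odd oj.
  rewrite /a'; case: (eqVneq j n) => [jn|_]; first by rewrite jn on in oj.
  by rewrite a0 b0 eqxx.
- apply/eqP; rewrite eqn_leq; apply/andP; split.
    apply/bigmax_leqP_seq => j; rewrite mem_filter mem_iota /=.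
    by move=> /andP[_ /andP[_ +]] _; rewrite add1n ltnS.
  apply: (@leq_bigmax_seq _ _ _ id) => //.
  by rewrite mem_filter mem_iota /= a'n n0 add1n ltnSn.
- move=> t eft; have /= := fE t.
  rewrite big_ltn//.
  have [-> ->] : a 0%N = 0 /\ b 0%N = 0 by apply: ab0; rewrite on.
  rewrite !mul0r !add0r /tp_evalR /= add0r => ftE.
  have -> : \sum_(1 <= j < n.+1) (a' j * cos (j%:R * t) + b j * sin (j%:R * t))
            = f t + h * cos (n%:R * t).
    rewrite ftE !big_nat_recr//= {2}/a' eqxx.
    have -> : \sum_(1 <= j < n) (a' j * cos (j%:R * t) + b j * sin (j%:R * t)) =
              \sum_(1 <= j < n) (a j * cos (j%:R * t) + b j * sin (j%:R * t)).
      by apply: eq_big_nat => j /andP[_ jn]; rewrite /a' ltn_eqF.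
    by ring.
  have c1 := cos_geN1 (n%:R * t).
  have : - (e / 2) <= h * cos (n%:R * t).
    by rewrite /h; case: ifP => _; nra.
  lra.
Qed.

End ParitySpan.

(** * Placing the zeros of a product of sines in the gaps *)

Section Nodes.
Variable R : realType.
Implicit Types (A B : set R) (a b g t u : R).

Lemma sin_ge_sin_half g u : 0 < g -> g / 2 <= u <= pi - g / 2 ->
  sin (g / 2) <= sin u.
Proof.
move=> g0 /andP[gu ug]; have pi0 := pi_gt0 R.
have mono v : g / 2 <= v <= pi / 2 -> sin (g / 2) <= sin v.
  move=> /andP[gv vp].
  move: gv; rewrite le_eqVlt => /orP[/eqP->//|gv].
  by rewrite ltW// ltr_sin// in_itv/=; apply/andP; split; lra.
have [up|pu] := leP u (pi / 2); first by apply: mono; rewrite gu up.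
rewrite -[sin u]opprK -sinN -sinDpi; apply: mono; apply/andP; split; lra.
Qed.

Lemma prod_ge_exp (I : eqType) (s : seq I) (F : I -> R) (d : R) : 0 <= d ->
  (forall i, i \in s -> d <= F i) -> d ^+ size s <= \prod_(i <- s) F i.
Proof.
move=> d0; elim: s => [|i s IH] Fs /=; first by rewrite big_nil.
rewrite exprS big_cons; apply: ler_pM => //; first exact: exprn_ge0.
  by apply: Fs; rewrite mem_head.
by apply: IH => j js; apply: Fs; rewrite inE js orbT.
Qed.

(* Greedy choice: the next node lies g / 2 before the infimum c of the points of
   B after a, and one starts again from c with A and B exchanged.  As c is only
   in the closure of B, the hypothesis on a is a gap condition instead of A a. *)
Lemma alternation_nodes g (n : nat) A B a b :
  0 < g -> a <= b -> b - a <= pi -> b - a < n%:R * g ->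
  (forall x y, A x -> B y -> g <= `|x - y|) ->
  (forall y, B y -> a <= y <= b -> a + g <= y) ->
  exists s : seq R,
    [/\ (size s)%:R * g <= b - a,
        (forall u, u \in s -> a + g / 2 <= u <= b - g / 2),
        (forall t, A t -> a <= t <= b ->
           sin (g / 2) ^+ size s <= \prod_(u <- s) sin (u - t)) &
        (forall t, B t -> a <= t <= b ->
           sin (g / 2) ^+ size s <= - \prod_(u <- s) sin (u - t))].
Proof.
move=> g0; elim: n A B a b => [|n IH] A B a b ab bap ban AB Ba.
  by move: ban; rewrite mul0r subr_lt0 ltNge ab.
pose C := B `&` [set y | a <= y <= b].
have [Cne|C0] := pselect (C !=set0); last first.
  exists [::]; split=> //=; first by rewrite mul0r subr_ge0.
    by move=> t _ _; rewrite big_nil.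
  by move=> t Bt tab; case: C0; exists t.
have lbC : has_lbound C by exists a => y [_ /andP[]].
pose c := inf C.
have Cc y : C y -> c <= y by apply: ge_inf.
have agc : a + g <= c by apply: lb_le_inf => // y [By yab]; exact: Ba.
have cb : c <= b.
  by have [y Cy] := Cne; apply: le_trans (Cc _ Cy) _; have [_ /andP[]] := Cy.
have near_c e : 0 < e -> exists2 y, C y & y < c + e.
  by move=> e0; have := @inf_adherent R C e e0 (conj Cne lbC) => -[y]; exists y.
(* Points of [B] accumulate at [c] or attain it, so [c] inherits their distance [g] from [A], on its
   right here and on its left in [cA]. *)
have Ac t : A t -> c <= t -> c + g <= t.
  move=> At ct; have [//|tcg] := leP (c + g) t.
  have [y Cy yc] := near_c g g0.
  have := AB t y At Cy.1; have := Cc _ Cy.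
  rewrite ler_normr => ? /orP[?|?]; lra.
have cA t : A t -> t < c -> t <= c - g.
  move=> At tc; apply/ler_addgt0Pr => e e0.
  have [y Cy yc] := near_c e e0.
  have := AB t y At Cy.1; have := Cc _ Cy.
  rewrite ler_normr => ? /orP[?|?]; lra.
have bcpi : b - c <= pi by lra.
have bcn : b - c < n%:R * g by move: ban; rewrite -natr1 mulrDl mul1r; lra.
have BA x y : B x -> A y -> g <= `|x - y| by move=> Bx Ay; rewrite distrC; exact: AB.
have Ac' y : A y -> c <= y <= b -> c + g <= y by move=> Ay /andP[cy _]; exact: Ac.
have [s [sz sI sB sA]] := IH B A c b cb bcpi bcn BA Ac'.
have d0 : 0 <= sin (g / 2).
  apply: sin_ge0_pi; apply/andP; split; lra.
(* The new factor is positive left of the gap (c - g, c) and negative from [c] on. There it undoes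
   the sign change caused by exchanging [A] and [B]; before [c], all factors are positive. *)
exists (c - g / 2 :: s); split=> /=.
- by rewrite -natr1 mulrDl mul1r; lra.
- move=> u; rewrite inE => /orP[/eqP->|/sI/andP[? ?]]; apply/andP; split; lra.
- move=> t At /andP[ta tb]; rewrite exprS big_cons.
  have [ct|tc] := leP c t.
    rewrite -[X in _ <= X]opprK -mulNr -mulrN -[in X in _ <= X]sinN.
    apply: ler_pM => //; first exact: exprn_ge0.
      by apply: sin_ge_sin_half => //; have := Ac _ At ct => ?; apply/andP; split; lra.
    by apply: sA => //; rewrite ct.
  apply: ler_pM => //; first exact: exprn_ge0.
    by apply: sin_ge_sin_half => //; have := cA _ At tc => ?; apply/andP; split; lra.
  apply: prod_ge_exp => // u /sI /andP[cu ub].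
  by apply: sin_ge_sin_half => //; apply/andP; split; lra.
- move=> t Bt tab; have ct : c <= t by apply: Cc.
  move/andP: tab => [ta tb].
  rewrite exprS big_cons -mulNr -sinN.
  apply: ler_pM => //; first exact: exprn_ge0.
    by apply: sin_ge_sin_half => //; apply/andP; split; lra.
  by apply: sB => //; rewrite ct.
Qed.

(** Each factor changes sign under a half-turn. This yields the parity of the number of nodes and
    carries bounds from one half of the circle to the other. *)
Lemma prod_sinDpi (s : seq R) t :
  \prod_(u <- s) sin (u - (t + pi)) = (-1) ^+ size s * \prod_(u <- s) sin (u - t).
Proof.
elim: s => [|u s IH]; first by rewrite !big_nil mulr1.
rewrite !big_cons IH /= exprS.
have -> : sin (u - t) = - sin (u - (t + pi)) by rewrite -sinDpi; congr sin; ring.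
ring.
Qed.

End Nodes.

(** * Estimates for the arc-length metric through lifts to the line *)

Section CircleMetric.
Variable R : realType.
Implicit Types (s t : R) (x y : circle R) (X : set (circle R)).
Local Notation cpi := (\pi_(circle R))%qT.

Lemma cpiD2pi t (m : int) : cpi (t + pi *+ 2 *~ m) = cpi t.
Proof. by apply/eqP/circle_eqP; exists m; rewrite addrC addKr. Qed.

Lemma circle_lift a x : exists2 t, cpi t = x & a <= t < a + pi *+ 2.
Proof.
have pi2_gt0 : 0 < pi *+ 2 :> R by rewrite pmulrn_lgt0 ?pi_gt0.
pose m := Num.floor ((repr x - a) / (pi *+ 2)).
have /andP[m1 m2] : m%:~R <= (repr x - a) / (pi *+ 2) < (m + 1)%:~R.
  by rewrite floor_le floorD1_gt.
exists (repr x + pi *+ 2 *~ (- m)); first by rewrite cpiD2pi reprK.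
rewrite mulrNz -mulrzl.
move: m1 m2; rewrite ler_pdivlMr// ltr_pdivrMr// intrD mulrDl mul1r.
set v := _ * _ => m1 m2; apply/andP; split; lra.
Qed.

Lemma geodist_le s t (m : int) : geodist (cpi s) (cpi t) <= `|s - t + pi *+ 2 *~ m|.
Proof.
apply: ge_inf; first by exists 0; exact: geodist_has_lbound.
exists (s + pi *+ 2 *~ m) => /=; first exact: cpiD2pi.
by exists t => //; rewrite addrAC.
Qed.

(** The difference of any two lifts differs from s - t - pi by an odd multiple of pi, which has
    absolute value at least pi; the triangle inequality concludes. *)
Lemma geodist_ge s t : pi - `|s - t - pi| <= geodist (cpi s) (cpi t).
Proof.
apply: lb_le_inf; first by exists `|s - t|, s => //; exists t.
move=> _ [s' /= /eqP/circle_eqP[m sE] [t' /= /eqP/circle_eqP[m' tE] <-]].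
have -> : s' - t' = (s - t - pi) + pi * (1 + 2 * (m - m')%:~R).
  have -> : s' = s + pi *+ 2 *~ m by rewrite -sE; ring.
  have -> : t' = t + pi *+ 2 *~ m' by rewrite -tE; ring.
  by rewrite -!(mulrzl (pi *+ 2)) intrB; ring.
have pi0 := pi_gt0 R.
set w := s - t - pi; set v := _ * _.
suff : pi <= `|v|.
  have := ler_normB (w + v) w; rewrite addrAC subrr add0r; lra.
rewrite /v normrM gtr0_norm// -[leLHS]mulr1 ler_pM2l//.
rewrite -[1 + _]/(1%:~R + 2%:~R * _) -intrM -intrD -intr_norm -[leLHS]/(1%:~R) ler_int.
lia.
Qed.

Lemma geodist_le_diam X x y : X x -> X y -> geodist x y <= diam X.
Proof.
move=> Xx Xy; apply: sup_upper_bound; last by exists x => //; exists y.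
split; first by exists (geodist x y), x => //; exists y.
by exists pi => _ [u _ [v _ <-]]; exact: geodist_le_pi.
Qed.

End CircleMetric.

(** * Existence of a positive polynomial below the critical diameter *)

Section Positive.
Variable R : realType.
Local Notation cpi := (\pi_(circle R))%qT.

Lemma raked_positive_on (k : nat) (X : set (circle R)) : (1 <= k)%N ->
  diam X < 2 * pi * k%:R / (2 * k + 1)%:R ->
  exists p : trigpoly R,
    [/\ raked p, homogeneous p, degree p = (2 * k - 1)%N & positive_on p X].
Proof.
move=> k0 dX.
have on : odd (2 * k - 1) by rewrite oddB ?muln_gt0// oddM.
have pi0 := pi_gt0 R.
(* The construction needs a base point. For empty [X] positivity is vacuous, and the perturbed zero
   function has the right degree. *)
have [X0|[x0 Xx0]] : X = set0 \/ X !=set0.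
  by have [->|/set0P] := eqVneq X set0; [left|right].
  have [p [rp hp dp _]] :=
    parity_span_trigpoly on (@ltr01 R) (parity_span0 R (2 * k - 1)).
  by exists p; split=> // x; rewrite X0.
pose g := pi - diam X.
have n0 : 0 < (2 * k + 1)%:R :> R by rewrite ltr0n addn1.
have gk : pi < (2 * k + 1)%:R * g.
  move: dX; rewrite ltr_pdivlMr// /g natrD natrM; lra.
have g0 : 0 < g.
  by have := lt_trans pi0 gk; rewrite pmulr_rgt0.
have gpi : g <= pi.
  have := geodist_le_diam Xx0 Xx0; have := geodist_ge0 x0 x0; rewrite /g; lra.
(* Here [t] is a lift of a point of the antipodal set X + pi. *)
have Xsep s t : X (cpi s) -> X (cpi (t - pi)) -> g <= `|s - t|.
  move=> Xs Xt; have -> : s - t = s - (t - pi) - pi by ring.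
  apply: le_trans (_ : pi - geodist (cpi s) (cpi (t - pi)) <= _).
    by rewrite /g lerD2l lerN2; exact: geodist_le_diam.
  by rewrite lerBlDr addrC -lerBlDr; exact: geodist_ge.
pose a : R := repr x0; pose b := a + pi.
have Xa : X (cpi a) by rewrite /a reprK.
have Xb : X (cpi (b - pi)) by rewrite /b addrK.
have ab : a <= b by rewrite /b; lra.
have bapi : b - a <= pi by rewrite /b; lra.
have ban : b - a < (2 * k + 1)%:R * g by rewrite /b; lra.
have Ba y : X (cpi (y - pi)) -> a <= y <= b -> a + g <= y.
  move=> Xy /andP[ay yb]; have := Xsep _ _ Xa Xy; rewrite ler_normr => /orP[?|?]; lra.
have [s [sz _ sA sB]] :=
  @alternation_nodes R g (2 * k + 1) [set t | X (cpi t)]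
    [set t | X (cpi (t - pi))] a b g0 ab bapi ban Xsep Ba.
set d := sin (g / 2) ^+ size s in sA sB.
have d0 : 0 < d.
  by apply: exprn_gt0; apply: sin_gt0_pi; apply/andP; split; lra.
(* The product is positive at [a] and negative at its antipode [b]. *)
have os : odd (size s).
  have := sA a Xa; have := sB b Xb.
  rewrite lexx ab lexx /= {1}/b prod_sinDpi -signr_odd.
  case: odd => // /(_ isT) + /(_ isT); rewrite expr0 mul1r; lra.
(* The gaps fit into length pi, so there are at most 2k nodes, and oddness excludes 2k itself. *)
have ssz : (size s <= 2 * k - 1)%N.
  have : (size s < 2 * k + 1)%N.
    by rewrite -(ltr_nat R) -(ltr_pM2r g0); apply: le_lt_trans ban.
  rewrite addn1 ltnS leq_eqVlt => /orP[/eqP sE|]; first by rewrite sE oddM in os.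
  by rewrite -[in X in _ -> X]ltnS subn1 prednK// muln_gt0.
have ps : parity_span (2 * k - 1) (fun t => \prod_(u <- s) sin (u - t)).
  by apply: parity_span_widen (parity_span_prod_sin s) => //; rewrite os on.
have [p [rp hp dp pp]] := parity_span_trigpoly on d0 ps.
exists p; split=> // x Xx.
have [t tx /andP[at1 ta]] := circle_lift a x.
rewrite -tx tp_eval_pi; apply: pp.
(* On the second half-turn, t - pi lies in [a, b] and lifts a point of X + pi, where the product is
   negative; the half-turn makes it positive. *)
have [tb|bt] := leP t b; first by apply: sA; rewrite ?at1//= tx.
have := prod_sinDpi s (t - pi); rewrite subrK -signr_odd os expr1 mulN1r => ->.
apply: sB; last by apply/andP; split; move: bt ta; rewrite /b mulr2n; lra.
by rewrite /= -(cpiD2pi _ 1) mulr1z mulr2n addrA !subrK tx.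
Qed.

End Positive.

(** * Sums over the regular polygon, and its diameter *)

Section RegularPolygon.
Variable R : realType.
Local Notation cpi := (\pi_(circle R))%qT.

(** The sum telescopes, as 2 sin (x / 2) cos (i x) = sin (i x + x / 2) - sin (i x - x / 2). *)
Lemma sum_cos_arith (x : R) n : 2 * sin (x / 2) * \sum_(0 <= i < n) cos (i%:R * x) =
  sin (n%:R * x - x / 2) + sin (x / 2).
Proof.
elim: n => [|n IH]; first by rewrite big_nil mul0r mulr0 add0r sinN addNr.
rewrite big_nat_recr//= mulrDr IH.
have -> : n.+1%:R * x - x / 2 = n%:R * x + x / 2 by rewrite -natr1; field.
by rewrite sinB sinD; ring.
Qed.

Lemma sum_sin_arith (x : R) n : 2 * sin (x / 2) * \sum_(0 <= i < n) sin (i%:R * x) =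
  cos (x / 2) - cos (n%:R * x - x / 2).
Proof.
elim: n => [|n IH]; first by rewrite big_nil mul0r mulr0 add0r cosN subrr.
rewrite big_nat_recr//= mulrDr IH.
have -> : n.+1%:R * x - x / 2 = n%:R * x + x / 2 by rewrite -natr1; field.
by rewrite cosB cosD; ring.
Qed.

Definition vertex (n i : nat) : R := i%:R * (pi *+ 2 / n%:R).

Lemma sum_vertex_cos_sin n j : (0 < j < n)%N ->
  \sum_(0 <= i < n) cos (j%:R * vertex n i) = 0 /\
  \sum_(0 <= i < n) sin (j%:R * vertex n i) = 0.
Proof.
move=> /andP[j0 jn].
have n0' : (0 < n)%N by exact: ltn_trans jn.
have n0 : 0 < n%:R :> R by rewrite ltr0n.
have pi0 := pi_gt0 R.
pose x := j%:R * (pi *+ 2 / n%:R) : R.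
have ix i : j%:R * vertex n i = i%:R * x by rewrite /vertex /x mulrCA.
have nx : n%:R * x - x / 2 = - (x / 2) + pi *+ 2 *~ j%:Z.
  rewrite addrC -mulrzl; congr (_ + _).
  by rewrite /x mulrCA [n%:R * _]mulrC divfK ?gt_eqF.
(* Since 0 < j < n, x / 2 = pi j / n lies strictly between 0 and pi, so this factor can be
   cancelled. *)
have sx : 2 * sin (x / 2) != 0.
  have -> : x / 2 = pi * (j%:R / n%:R).
    by rewrite /x -mulr_natr; field; rewrite gt_eqF.
  rewrite mulf_neq0// gt_eqF// sin_gt0_pi//.
  rewrite mulr_gt0 ?divr_gt0 ?ltr0n//=.
  by rewrite -[ltRHS]mulr1 ltr_pM2l// ltr_pdivrMr// mul1r ltr_nat.
split; apply: (mulfI sx); rewrite mulr0; under eq_bigr do rewrite ix.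
  by rewrite sum_cos_arith nx sin_intperiod sinN addNr.
by rewrite sum_sin_arith nx cos_intperiod cosN subrr.
Qed.

Lemma sum_vertex_tp_evalR (p : trigpoly R) n : homogeneous p -> (degree p < n)%N ->
  \sum_(0 <= i < n) tp_evalR p (vertex n i) = 0.
Proof.
move=> p0 pn; rewrite /tp_evalR p0.
under eq_bigr do rewrite add0r.
rewrite exchange_big_nat/= big_nat big1// => j /andP[j1 jp].
rewrite big_split/= -!mulr_sumr.
(* [tp_size] may exceed the degree, even reach [n]; outside the spectrum the coefficients vanish. *)
have [jS|] := boolP (j \in spectrum p).
  have jd : (j <= degree p)%N by exact: (@leq_bigmax_seq _ _ xpredT id).
  have [|-> ->] := @sum_vertex_cos_sin n j; first by rewrite j1 (leq_ltn_trans jd).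
  by rewrite !mulr0 addr0.
rewrite mem_filter mem_iota add1n jp j1 !andbT negb_or !negbK.
by move=> /andP[/eqP-> /eqP->]; rewrite !mul0r addr0.
Qed.

Definition regular_polygon n : set (circle R) :=
  [set cpi (vertex n i) | i in [set i | (i < n)%N]].

Lemma diam_regular_polygon k :
  diam (regular_polygon (2 * k + 1)) = 2 * pi * k%:R / (2 * k + 1)%:R.
Proof.
set n := (2 * k + 1)%N; set X := regular_polygon n; have pi0 := pi_gt0 R.
have n0 : 0 < n%:R :> R by rewrite ltr0n /n addn1.
pose h : R := pi *+ 2 / n%:R.
have h0 : 0 < h by rewrite divr_gt0// pmulrn_lgt0.
have -> : 2 * pi * k%:R / n%:R = k%:R * h by rewrite /h -mulr_natr; ring.
have nh : pi *+ 2 = n%:R * h by rewrite /h mulrCA divff ?mulr1// gt_eqF.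
have nE : n%:R = 2 * k%:R + 1 :> R by rewrite /n natrD natrM.
have Xv i : (i < n)%N -> X (cpi (vertex n i)) by move=> ?; exists i.
apply/eqP; rewrite eq_le; apply/andP; split.
  apply: sup_le_ub.
    have X0 : X (cpi (vertex n 0)) by apply: Xv; rewrite /n addn1.
    by exists (geodist (cpi (vertex n 0)) (cpi (vertex n 0))),
      (cpi (vertex n 0)) => //; exists (cpi (vertex n 0)).
  move=> _ [_ [i /= iltn <-] [_ [j /= jltn <-] <-]].
  (* Modulo n = 2k + 1, every index difference has a representative between -k and k. *)
  suff [m ijm] : exists m : int, `|i%:Z - j%:Z + n%:Z * m| <= k%:Z.
    apply: le_trans (geodist_le _ _ m) _.
    rewrite nh -mulrzl /vertex -/h.
    have -> : i%:R * h - j%:R * h + m%:~R * (n%:R * h) =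
              (i%:Z - j%:Z + n%:Z * m)%:~R * h.
      by rewrite intrD intrB intrM; ring.
    rewrite normrM (gtr0_norm h0) ler_pM2r// -intr_norm.
    by rewrite -[k%:R]/(k%:Z%:~R) ler_int.
  have [ij|ij] := leP `|i%:Z - j%:Z| k%:Z; first by exists 0; lia.
  by case: (leqP i j) => ?; [exists 1|exists (- 1)]; lia.
(* Vertices 0 and k attain the bound: pi = (k + 1/2) h, so k h falls short of pi by h / 2 only. *)
have := geodist_ge (vertex n k) (vertex n 0).
have kn : (k < n)%N by rewrite /n; lia.
have n0' : (0 < n)%N by lia.
have := geodist_le_diam (Xv _ kn) (Xv _ n0').
have -> : vertex n k - vertex n 0 - pi = - (h / 2).
  rewrite /vertex -/h; have -> : pi = n%:R * h / 2 :> R by rewrite -nh; field.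
  by rewrite nE; field.
rewrite normrN gtr0_norm => [dX|]; last exact: divr_gt0 h0 (ltr0Sn _ _).
move: nh; rewrite nE mulr2n; lra.
Qed.

End RegularPolygon.

Unset Implicit Arguments.

Theorem theorem4 (R : realType) (k : nat) (hk : (1 <= k)%N) :
  (forall X : set (circle R),
     diam X < 2 * pi * k%:R / (2 * k + 1)%:R ->
     exists p : trigpoly R,
       [/\ raked p, homogeneous p, degree p = (2 * k - 1)%N & positive_on p X])
  /\
  (exists X : set (circle R),
     diam X = 2 * pi * k%:R / (2 * k + 1)%:R /\
     ~ exists p : trigpoly R,
         [/\ raked p, homogeneous p, degree p = (2 * k - 1)%N & positive_on p X]).
Proof.
split=> [X dX|]; first exact: raked_positive_on.
exists (regular_polygon (2 * k + 1)); split; first exact: diam_regular_polygon.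
move=> [p [_ hp dp pX]].
have pdn : (degree p < 2 * k + 1)%N by rewrite dp; lia.
(* Positivity at every vertex would make this zero sum strictly positive. *)
have := sum_vertex_tp_evalR hp pdn; apply/eqP; rewrite gt_eqF//.
have n0 : (0 < 2 * k + 1)%N by rewrite addn1.
have pv i : (i < 2 * k + 1)%N -> 0 < tp_evalR p (vertex R (2 * k + 1) i).
  by move=> ik; rewrite -tp_eval_pi; apply: pX; exists i.
rewrite big_ltn// ltr_pwDl ?pv// big_nat; apply: sumr_ge0 => i /andP[_ ik].
by rewrite ltW ?pv.
Qed.
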